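(* Let $n\geqslant 2$. Then the sequence $(\eta_n(m))_{m\geqslant 0}$ (defined by matrix products in the context) has mean value zero, that is, $$\lim_{m\to\infty}\frac1m\sum_{j=0}^{m-1}\eta_n(j)=0.$$
   Context: Fix $n\geqslant 2$. The balanced $n$-point correlations $\eta(m_1,\ldots,m_{n-1})$ of the Thue--Morse sequence $(t_k)_{k\geqslant0}$ ($t_0=1$, $t_{2k}=t_k$, $t_{2k+1}=-t_k$) are $\eta(m_1,\ldots,m_{n-1})=\lim_{N\to\infty}\frac1N\sum_{k=0}^{N-1}t_kt_{k+m_1}\cdots t_{k+m_{n-1}}$ for $m_i\in\mathbb{N}_0$. They satisfy, for $m_i\geqslant 0$, $r_i\in\{0,1\}$ and $r=r_1+\cdots+r_{n-1}$, the recursion $\eta(2m_1+r_1,\ldots,2m_{n-1}+r_{n-1})=\frac{(-1)^r}{2}\bigl(\eta(m_1,\ldots,m_{n-1})+(-1)^n\eta(m_1+r_1,\ldots,m_{n-1}+r_{n-1})\bigr)$. Let $\boldsymbol{\eta}(m_1,\ldots,m_{n-1})$ be the column vector of length $2^{n-1}$ with entries $\eta(m_1+s_1,\ldots,m_{n-1}+s_{n-1})$, $s\in\{0,1\}^{n-1}$ in lexicographic order. Using the recursion, one obtains matrices $\boldsymbol{B}_{(r_1,\ldots,r_{n-1})}$ with $$\boldsymbol{\eta}(2m_1+r_1,\ldots,2m_{n-1}+r_{n-1})=\boldsymbol{B}_{(r_1,\ldots,r_{n-1})}\,\boldsymbol{\eta}(m_1,\ldots,m_{n-1}).$$ Explicitly,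 with rows and columns indexed by $s,u\in\{0,1\}^{n-1}$ in lexicographic order, and $r=(r_1,\ldots,r_{n-1})$, $$(\boldsymbol{B}_{r})_{s,u}=\frac{(-1)^{|r\oplus s|}}{2}\bigl(\delta_{u,\,r\wedge s}+(-1)^n\delta_{u,\,r\vee s}\bigr),$$ where $\oplus,\wedge,\vee$ are the componentwise exclusive or, minimum and maximum, and $|\cdot|$ is the number of $1$s. For $i\in\{0,1,\ldots,2^{n-1}-1\}$ with ($(n-1)$-digit) binary expansion $r_1r_2\cdots r_{n-1}$ (most significant digit first), put $\boldsymbol{B}_i=\boldsymbol{B}_{(r_1,\ldots,r_{n-1})}$. For $m\geqslant 0$ with base-$2^{n-1}$ expansion $i_s\cdots i_1i_0$ ($i_0$ the least significant digit, no leading zeros; $m=0$ has the single digit $0$), define $$\eta_n(m)=\boldsymbol{e}_1^{T}\boldsymbol{B}_{i_0}\boldsymbol{B}_{i_1}\cdots\boldsymbol{B}_{i_s}\boldsymbol{e}_1,$$ where $\boldsymbol{e}_1$ is the first standard basis column vector of length $2^{n-1}$. *)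

(* Defs.v *)
From HB Require Import structures.
From mathcomp Require Import all_boot all_order all_algebra.
From mathcomp Require Import all_classical all_reals all_analysis.
Set Implicit Arguments.
Unset Strict Implicit.
Unset Printing Implicit Defensive.
Import Order.TTheory GRing.Theory Num.Theory.
Import numFieldNormedType.Exports.
Local Open Scope ring_scope.

(* Binary words of length k, as functions on positions; position 0 is the
   leftmost letter, i.e. the most significant digit. *)
Definition word (k : nat) := {ffun 'I_k -> bool}.

(* The k-digit binary expansion of i < 2 ^ k.  It is also the word of rank i
   (counted from 0) in the lexicographic order on {0,1}^k, so it serves both to
   read a digit in base 2 ^ k and to label rows and columns of matrices. *)
Definition bits (k i : nat) : word k :=
  [ffun j : 'I_k => odd (i %/ 2 ^ (k - j.+1))%N].

Definition wxor (k : nat) (r s : word k) : word k := [ffun j => r j (+) s j].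
Definition wand (k : nat) (r s : word k) : word k := [ffun j => r j && s j].
Definition wor (k : nat) (r s : word k) : word k := [ffun j => r j || s j].
Definition weight (k : nat) (r : word k) : nat := #|[pred j | r j]|.

(* With eta the vector of the values eta(m_1 + s_1, ..., m_k + s_k), k = n - 1,
   of the n-point Thue-Morse correlations, the recursion at the argument
   2 m + r + s = 2 (m + (r /\ s)) + (r (+) s) gives
   eta(2 m + r) = Bmx r *m eta(m). *)
Definition Bmx (R : realType) (n : nat) (r : word n.-1) : 'M[R]_(2 ^ n.-1) :=
  \matrix_(i < 2 ^ n.-1, j < 2 ^ n.-1)
    let s := bits n.-1 i in
    let u := bits n.-1 j in
    (-1) ^+ weight (wxor r s) / 2 *
      ((u == wand r s)%:R + (-1) ^+ n * (u == wor r s)%:R).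

Definition e1 (R : realType) (d : nat) : 'cV[R]_d :=
  \col_(i < d) ((i : nat) == 0%N)%:R.

(* Base-b digits of m, least significant first, for 1 < b; trunc_log b 0 = 0,
   so m = 0 has the single digit 0. *)
Definition digits (b m : nat) : seq nat :=
  [seq (m %/ b ^ j %% b)%N | j <- iota 0 (trunc_log b m).+1].

(* The product is taken in the order of the list, hence B_{i_0} comes first.  It
   is applied to e1, not to the vector eta(0, ..., 0), so these numbers are in
   general not themselves values of the correlations. *)
Definition eta (R : realType) (n m : nat) : R :=
  ((e1 R (2 ^ n.-1))^T *m
     (\prod_(i <- digits (2 ^ n.-1) m) Bmx R (bits n.-1 i)) *m
     e1 R (2 ^ n.-1)) 0 0.

(* Main.v *)
(* Every digit matrix has rows of absolute sum at most 1, whereas the sum of all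
   D = 2 ^ (n - 1) of them has nonzero rows only at the indices 0...0 and 1...1,
   with entries +-1/2, so its rows have absolute sum at most D / 2 instead of the
   trivial D.  Stripping the least significant digit thus bounds the partial sum
   of length N by D / 2 times the one of length N / D, up to O(1), and L
   iterations give the bound N / 2 ^ L + C_L. *)
Require Import Defs.
From mathcomp Require Import all_boot all_order all_algebra.
From mathcomp Require Import all_classical all_reals all_analysis.
From mathcomp Require Import zify lra.
Import Order.TTheory GRing.Theory Num.Theory.
Import numFieldNormedType.Exports.
Local Open Scope classical_set_scope.
Local Open Scope ring_scope.

(** * Digits in base [b] *)

Lemma digits_small (b j : nat) : (1 < b)%N -> (j < b)%N -> digits b j = [:: j].
Proof.
move=> b1 jb; have -> : digits b j = [seq (j %/ b ^ i %% b)%N | i <- iota 0 1].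
  by rewrite /digits (eqP (_ : trunc_log b j == 0%N)) // trunc_log_eq0; lia.
by rewrite /= expn0 divn1 modn_small.
Qed.

(** For [m = 0] the right-hand side would carry a leading zero, whence [0 < m]. *)
Lemma digits_cons (b m j : nat) : (1 < b)%N -> (0 < m)%N -> (j < b)%N ->
  digits b (m * b + j) = j :: digits b m.
Proof.
move=> b1 m0 jb; have b0 : (0 < b)%N by apply: ltnW.
have logE : trunc_log b (m * b + j) = (trunc_log b m).+1.
  apply: trunc_log_eq => //.
  (* With [t = trunc_log b m]: b^(t+1) <= m b + j < (m+1) b <= b^(t+2). *)
  have /andP[lo hi] := trunc_log_bounds b1 m0.
  rewrite !(expnSr b) (leq_trans _ (leq_addr _ _)) ?leq_mul2r ?lo ?orbT //=.
  rewrite -expnSr (@leq_trans (m.+1 * b)) //; first by rewrite mulSn addnC ltn_add2r.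
  by rewrite leq_mul2r hi orbT.
rewrite /digits logE -add1n iotaD map_cat add0n [X in X ++ _]/= expn0 divn1 modnMDl.
rewrite modn_small // (iotaDl 1 0) -map_comp; congr (_ :: _); apply: eq_map => i /=.
by rewrite add1n expnS divnMA divnMDl // (divn_small jb) addn0.
Qed.

(** * Binary words as labels *)

Lemma bits_inj (k : nat) : injective (fun i : 'I_(2 ^ k) => bits k i).
Proof.
(* Positions are counted here from the least significant bit, so that induction on the length can
   halve [i]. *)
have odd_inj : forall k i i', (i < 2 ^ k)%N -> (i' < 2 ^ k)%N ->
    (forall t, (t < k)%N -> odd (i %/ 2 ^ t) = odd (i' %/ 2 ^ t)) -> i = i'.
  elim=> [|l IH] i i' iD iD' eq_odd.
    by move: iD iD'; rewrite expn0 !ltnS !leqn0 => /eqP-> /eqP->.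
  rewrite -(odd_double_half i) -(odd_double_half i').
  have := eq_odd 0%N isT; rewrite expn0 !divn1 => ->.
  rewrite (IH i./2 i'./2) //.
  - by rewrite -divn2 ltn_divLR // -expnSr.
  - by rewrite -divn2 ltn_divLR // -expnSr.
  - by move=> t tl; have := eq_odd t.+1 tl; rewrite expnS !divnMA !divn2.
move=> i i' /ffunP eq_bits; apply: val_inj.
apply: (odd_inj k); [exact: ltn_ord | exact: ltn_ord | move=> t tk].
have lt_j : (k - t.+1 < k)%N by lia.
by have := eq_bits (Ordinal lt_j); rewrite !ffunE /= (_ : k - (k - t.+1).+1 = t)%N //; lia.
Qed.

Lemma bits_bij (k : nat) : bijective (fun i : 'I_(2 ^ k) => bits k i).
Proof.
apply: inj_card_bij; first exact: bits_inj.
by rewrite card_ffun card_bool !card_ord.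
Qed.

(** * Row sums of one digit matrix *)

Lemma sum_indicator_le1 (R : realType) (I : finType) (T : eqType) (f : I -> T)
  (x : T) : injective f -> \sum_i (f i == x)%:R <= 1 :> R.
Proof.
move=> f_inj; rewrite -natr_sum lern1.
have -> : (\sum_i (f i == x) = #|[pred i | f i == x]|)%N.
  by rewrite -sum1_card [RHS]big_mkcond; apply: eq_bigr => i _; rewrite inE; case: eqP.
apply/card_le1_eqP => i j; rewrite !inE => /eqP fi /eqP fj.
by apply: f_inj; rewrite fi fj.
Qed.

(** The maximal absolute row sum is the operator norm for the maximum norm. *)
Lemma norm_mulmx_le (R : realType) (p q r : nat) (A : 'M[R]_(p, q))
  (w : 'M[R]_(q, r)) (a c : R) : 0 <= a ->
  (forall i, \sum_j `|A i j| <= c) -> (forall i j, `|w i j| <= a) ->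
  forall i j, `|(A *m w) i j| <= c * a.
Proof.
move=> a0 hA hw i j; rewrite mxE (le_trans (ler_norm_sum _ _ _)) //.
apply: (@le_trans _ _ (\sum_l `|A i l| * a)).
  by apply: ler_sum => l _; rewrite normrM ler_wpM2l.
by rewrite -mulr_suml ler_wpM2r.
Qed.

Lemma weightE (R : realType) (k : nat) (r : word k) :
  (-1) ^+ weight r = \prod_j (-1) ^+ r j :> R.
Proof.
by rewrite /weight -sum1_card -expr_sum big_mkcond.
Qed.

(** At most one column is labelled [wand r s] and at most one [wor r s]; each contributes at most
    1/2. *)
Lemma Bmx_row_sum (R : realType) (n : nat) (r : word n.-1) (i : 'I_(2 ^ n.-1)) :
  \sum_j `|Bmx R r i j| <= 1.
Proof.
set s := bits n.-1 i.
have le_half (j : 'I_(2 ^ n.-1)) : `|Bmx R r i j| <=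
    2^-1 * (bits n.-1 j == wand r s)%:R + 2^-1 * (bits n.-1 j == wor r s)%:R.
  rewrite mxE -/s -mulrDr !normrM !normrX !normrN1 !expr1n mul1r.
  rewrite ger0_norm ?invr_ge0 // ler_wpM2l ?invr_ge0 //.
  by rewrite (le_trans (ler_normD _ _)) // normrM normrX normrN1 expr1n mul1r !normr_nat.
rewrite (le_trans (ler_sum _ (fun j _ => le_half j))) // big_split /= -!mulr_sumr.
have h := @sum_indicator_le1 R _ _ _ _ (@bits_inj n.-1).
by have := h (wand r s); have := h (wor r s); lra.
Qed.

(** * The sum of all digit matrices *)

Lemma eq_word (R : realType) (k : nat) (u v : word k) :
  (u == v)%:R = \prod_j (u j == v j)%:R :> R.
Proof.
have [->|uv] := eqVneq u v; first by rewrite big1 // => j _; rewrite eqxx.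
have [j uvj] : exists j, u j != v j.
  apply/existsP; rewrite -negb_forall; apply: contra uv => /forallP uv.
  by apply/eqP/ffunP => j; apply/eqP.
by rewrite (bigD1 j) //= (negbTE uvj) mul0r.
Qed.

(** Sign and indicator both factor over the positions, so the sum over words distributes into a
    product of sums over single letters. *)
Lemma sum_sign_map2 (R : realType) (k : nat) (op : bool -> bool -> bool)
  (s u : word k) :
  \sum_(r : word k) (-1) ^+ weight (wxor r s) *
    (u == [ffun j => op (r j) (s j)])%:R =
  \prod_j \sum_b (-1) ^+ (b (+) s j) * (u j == op b (s j))%:R :> R.
Proof.
rewrite bigA_distr_bigA /=; apply: eq_bigr => r _.
by rewrite weightE eq_word -big_split; apply: eq_bigr => j _; rewrite !ffunE.
Qed.

(* A letter r_j that does not affect the target word sums to 1 - 1 = 0. *)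
Lemma norm_sum_wand (R : realType) (k : nat) (s u : word k) :
  `|\sum_(r : word k) (-1) ^+ weight (wxor r s) * (u == wand r s)%:R : R|
  = \prod_j (s j)%:R.
Proof.
rewrite (sum_sign_map2 R k andb) normr_prod; apply: eq_bigr => j _.
rewrite big_bool /=; case: (s j); case: (u j) => /=;
  by rewrite ?(expr0, expr1, mulr0, mulr1, addr0, add0r, addNr, normrN, normr1, normr0).
Qed.

(** Dually, [s j = 1] absorbs the letter [r j], so only s = 0...0 survives. *)
Lemma norm_sum_wor (R : realType) (k : nat) (s u : word k) :
  `|\sum_(r : word k) (-1) ^+ weight (wxor r s) * (u == wor r s)%:R : R|
  = \prod_j (~~ s j)%:R.
Proof.
rewrite (sum_sign_map2 R k orb) normr_prod; apply: eq_bigr => j _.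
rewrite big_bool /=; case: (s j); case: (u j) => /=;
  by rewrite ?(expr0, expr1, mulr0, mulr1, addr0, add0r, subrr, normrN, normr1, normr0).
Qed.

Lemma sum_Bmx_entry (R : realType) (n : nat) (i j : 'I_(2 ^ n.-1)) :
  (2 <= n)%N ->
  `|(\sum_(l < 2 ^ n.-1) Bmx R (bits n.-1 l)) i j| <= 2^-1.
Proof.
move=> hn; have k0 : (0 < n.-1)%N by lia.
rewrite summxE.
set s := bits n.-1 i; set u := bits n.-1 j.
rewrite -(reindex _ (onW_bij _ (bits_bij n.-1)) (P := xpredT)
  (F := fun r => Bmx R r i j)) /=.
have -> : \sum_r Bmx R r i j = 2^-1 *
    (\sum_(r : word n.-1) (-1) ^+ weight (wxor r s) * (u == wand r s)%:R
     + (-1) ^+ n *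
       \sum_(r : word n.-1) (-1) ^+ weight (wxor r s) * (u == wor r s)%:R).
  rewrite mulr_sumr -big_split mulr_sumr; apply: eq_bigr => r _.
  by rewrite mxE -/s -/u /=; lra.
rewrite normrM ger0_norm ?invr_ge0 // -[leRHS]mulr1 ler_wpM2l ?invr_ge0 //.
rewrite (le_trans (ler_normD _ _)) // normrM normrX normrN1 expr1n mul1r.
rewrite norm_sum_wand norm_sum_wor.
(* The two rows s = 0 and s = 1...1 are distinct because n - 1 > 0. *)
have le_fst (f : 'I_n.-1 -> bool) : \prod_j0 (f j0)%:R <= (f (Ordinal k0))%:R :> R.
  rewrite (bigD1 (Ordinal k0)) //= ler_piMr ?ler0n //.
  by apply: prodr_ile1 => j' _; rewrite ler0n lern1 leq_b1.
(* Exactly one of [s] and its negation is 1 at position 0, so the two products add up to at most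
   1. *)
apply: (le_trans (lerD (le_fst s) (le_fst (fun j => ~~ s j)))).
by case: (s _); rewrite /= ?addr0 ?add0r.
Qed.

Lemma sum_Bmx_row_sum (R : realType) (n : nat) (i : 'I_(2 ^ n.-1)) :
  (2 <= n)%N ->
  \sum_j `|(\sum_(l < 2 ^ n.-1) Bmx R (bits n.-1 l)) i j| <= (2 ^ n.-1)%:R / 2.
Proof.
move=> hn; rewrite (le_trans (ler_sum _ (fun j _ => sum_Bmx_entry R n i j hn))) //.
by rewrite sumr_const card_ord -[leLHS]mulr_natl.
Qed.

(** * Partial sums and their recursion *)

Section MeanValue.
Variables (R : realType) (n : nat).
Hypothesis hn : (2 <= n)%N.
Let D := (2 ^ n.-1)%N.
Let B (j : nat) := Bmx R (bits n.-1 j).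

(** [eta R n m] is the top entry; all entries are kept because stripping a digit mixes them. *)
Definition vec_eta (m : nat) : 'cV[R]_(2 ^ n.-1) :=
  (\prod_(i <- digits D m) B i) *m e1 R D.

(* Differs from [vec_eta] at 0 only, where the empty expansion of 0 is used in
   place of the single digit 0; this makes [vec_eta_rec] hold for all [m]. *)
Definition vec_eta' (m : nat) : 'cV[R]_(2 ^ n.-1) :=
  if m == 0%N then e1 R D else vec_eta m.

Lemma D_gt1 : (1 < D)%N.
Proof. by rewrite -{1}(expn0 2) ltn_exp2l //; lia. Qed.

Lemma D_gt0 : (0 < D)%N.
Proof. exact: ltnW D_gt1. Qed.

Lemma vec_eta_rec (m j : nat) : (j < D)%N ->
  vec_eta (m * D + j) = B j *m vec_eta' m.
Proof.
move=> jD; rewrite /vec_eta' /vec_eta; case: (posnP m) => [->|m0] /=.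
  by rewrite mul0n add0n digits_small ?D_gt1 // big_seq1.
by rewrite digits_cons ?D_gt1 // big_cons -mulmxA.
Qed.

Lemma norm_e1_le (i : 'I_(2 ^ n.-1)) j : `|e1 R D i j| <= 1.
Proof. by rewrite mxE normr_nat lern1 leq_b1. Qed.

(** Row sums at most 1 mean that no factor increases the maximum norm. *)
Lemma norm_prod_Bmx_le (s : seq nat) i j :
  `|((\prod_(l <- s) B l) *m e1 R D) i j| <= 1.
Proof.
elim: s i j => [|a s IH] i j; first by rewrite big_nil mul1mx norm_e1_le.
rewrite big_cons -mulmxA -[leRHS]mulr1.
by apply: norm_mulmx_le => // l; apply: Bmx_row_sum.
Qed.

Lemma norm_vec_eta_le (m : nat) i j : `|vec_eta m i j| <= 1.
Proof. exact: norm_prod_Bmx_le. Qed.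

(** In m D + l the digit l runs independently of m, and its matrix is the leftmost factor. *)
Lemma sum_vec_eta_rec (q : nat) :
  \sum_(0 <= m < q * D) vec_eta m =
  (\sum_(l < D) B l) *m \sum_(0 <= m < q) vec_eta' m.
Proof.
rewrite big_nat_mul mulmx_sumr; apply: eq_bigr => m _.
rewrite mulmx_suml -{1}(add0n (m * D)%N) big_addn mulSn addnK big_mkord.
by apply: eq_bigr => l _; rewrite addnC vec_eta_rec.
Qed.

(** Only the terms at 0 differ, and both have entries of absolute value at most 1. *)
Lemma sum_vec_eta'_near (q : nat) i j :
  `|(\sum_(0 <= m < q) vec_eta' m) i j| <=
  `|(\sum_(0 <= m < q) vec_eta m) i j| + 2.
Proof.
case: q => [|q]; first by rewrite !big_geq // mxE normr0 add0r.
rewrite !big_nat_recl // {1}/vec_eta' /=.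
have addE (a b : 'cV[R]_D) : (a + b) i j = a i j + b i j by rewrite mxE.
rewrite (eq_bigr (fun m => vec_eta m.+1)) // !addE.
have := norm_e1_le i j; have := norm_vec_eta_le 0 i j.
set x := vec_eta 0 i j; set y := e1 _ _ i j.
set z := (\sum_(0 <= m < q) vec_eta m.+1) i j.
move=> hx hy; have -> : y + z = (x + z) + (y - x) by lra.
rewrite (le_trans (ler_normD _ _)) // lerD2l (le_trans (ler_normB _ _)) //; lra.
Qed.

Lemma norm_sum_vec_eta_le (a b : nat) i j : (a <= b)%N ->
  `|(\sum_(a <= m < b) vec_eta m) i j| <= (b - a)%:R.
Proof.
move=> ab; rewrite summxE (le_trans (ler_norm_sum _ _ _)) //.
apply: (@le_trans _ _ (\sum_(a <= m < b) 1)); last by rewrite sumr_const_nat.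
by apply: ler_sum => m _; apply: norm_vec_eta_le.
Qed.

Lemma sum_vec_eta_le (L : nat) : exists C : R, 0 <= C /\
  forall N i j, `|(\sum_(0 <= m < N) vec_eta m) i j| <= 2^-1 ^+ L * N%:R + C.
Proof.
elim: L => [|L [C [C0 IH]]].
  exists 0; split=> // N i j; rewrite expr0 mul1r addr0.
  by have := norm_sum_vec_eta_le 0 N i j isT; rewrite subn0.
have D0 : 0 <= D%:R :> R by rewrite ler0n.
(* The 2 pays for replacing [vec_eta'] by [vec_eta], D / 2 is the row sum bound, and the last D
   covers the incomplete block of N mod D terms. *)
exists (D%:R / 2 * (C + 2) + D%:R); split.
  by rewrite addr_ge0 // !mulr_ge0 ?invr_ge0 // addr_ge0.
move=> N i j; set q := (N %/ D)%N.
have qN : (q * D <= N)%N by rewrite leq_trunc_div.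
rewrite (big_cat_nat (n := (q * D)%N)) //= mxE (le_trans (ler_normD _ _)) //.
rewrite addrA lerD //; last first.
  rewrite (le_trans (norm_sum_vec_eta_le _ _ i j qN)) // ler_nat.
  by rewrite {1}(divn_eq N D) addKn ltnW // ltn_mod D_gt0.
rewrite sum_vec_eta_rec.
have p0 : 0 <= 2^-1 ^+ L :> R by rewrite exprn_ge0 // invr_ge0.
have bound l l' : `|(\sum_(0 <= m < q) vec_eta' m) l l'| <= 2^-1 ^+ L * q%:R + C + 2.
  by rewrite (le_trans (sum_vec_eta'_near _ _ _)) // lerD2r.
have b0 : 0 <= 2^-1 ^+ L * q%:R + C + 2 :> R by rewrite !addr_ge0 // mulr_ge0.
rewrite (le_trans (norm_mulmx_le _ _ _ _ _ _ _ _ b0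
  (fun l => sum_Bmx_row_sum R n l hn) bound i j)) //.
rewrite -addrA mulrDr lerD2r exprS.
have -> : (2 ^ n.-1)%:R / 2 * (2^-1 ^+ L * q%:R) = 2^-1 * 2^-1 ^+ L * (q * D)%:R :> R.
  by rewrite natrM -/D; lra.
by rewrite ler_wpM2l ?ler_nat // mulr_ge0 // invr_ge0.
Qed.

Lemma sum_eta_le (L : nat) : exists C : R, 0 <= C /\
  forall N, `|\sum_(0 <= m < N) eta R n m| <= 2^-1 ^+ L * N%:R + C.
Proof.
have [C [C0 hC]] := sum_vec_eta_le L; exists C; split=> // N.
have -> : \sum_(0 <= m < N) eta R n m =
    ((e1 R D)^T *m \sum_(0 <= m < N) vec_eta m) 0 0.
  by rewrite mulmx_sumr summxE; apply: eq_bigr => m _; rewrite /vec_eta mulmxA.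
(* The factor 1 bounds the absolute row sum of the transpose of [e1]. *)
rewrite -[leRHS]mul1r; apply: norm_mulmx_le => // [|i].
  by rewrite addr_ge0 // mulr_ge0 // exprn_ge0 // invr_ge0.
rewrite (eq_bigr (fun j : 'I_D => ((j : nat) == 0%N)%:R)); last first.
  by move=> j _; rewrite !mxE normr_nat.
exact/sum_indicator_le1/val_inj.
Qed.

End MeanValue.

Theorem theorem4p9 (R : realType) (n : nat) (hn : (2 <= n)%N) :
  (fun m : nat => m%:R^-1 * \sum_(0 <= j < m) eta R n j) @ \oo --> (0 : R).
Proof.
apply/cvgrPdist_le => e e0.
have half : `|2^-1 : R| < 1 by rewrite ger0_norm ?invr_ge0 // invf_lt1 // ltr1n.
have e20 : 0 < e / 2 by rewrite divr_gt0.
(* [L] is fixed first, with 2^(-L) <= e/2; the constant [C] then depends on [L] but not on [m]. *)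
have /cvgrPdist_le /(_ _ e20) [L _ /(_ L (leqnn L))] := cvg_expr half.
rewrite /= sub0r normrN ger0_norm ?exprn_ge0 ?invr_ge0 // => hL.
have [C [C0 hC]] := sum_eta_le R n hn L.
near=> m.
have m0 : 0 < m%:R :> R by rewrite ltr0n; near: m; exists 1%N.
(* For such [m] the other half of the error, e/2 * m, absorbs [C]. *)
have mC : C / (e / 2) <= m%:R by near: m; apply: nbhs_infty_ger.
rewrite sub0r normrN normrM normfV normr_nat mulrC ler_pdivrMr //.
rewrite (le_trans (hC m)) //.
have -> : e * m%:R = e / 2 * m%:R + e / 2 * m%:R by lra.
apply: lerD; first by rewrite ler_wpM2r // ltW.
by rewrite mulrC -ler_pdivrMr.
Unshelve. all: by end_near.
Qed.
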